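(* Let $R$ be an indecomposable commutative ring with $|R|\ge3$, $P$ a set, and $\eta$ a local automorphism of $\Pi=\prod_{x\in P}Re_x$ such that $e_x\in\operatorname{Im}(\eta)$ for all $x\in P$. Then $\eta$ is an $R$-algebra automorphism, and $\eta=\widehat\rho$ for some permutation $\rho:P\to P$.
   Context: A commutative ring $R$ with identity is indecomposable if $0,1$ are its only idempotents. $\Pi=\prod_{x\in P}Re_x$ is the full cartesian product of $|P|$ copies of $R$, an $R$-algebra with componentwise operations; its elements are written $a=\sum_{x\in P}a_xe_x$ with arbitrary $a_x\in R$, and $e_x$ is the element with $x$-coordinate $1$ and all other coordinates $0$. A local automorphism of $\Pi$ is an $R$-linear map $\eta:\Pi\to\Pi$ such that for each $a\in\Pi$ there is an $R$-algebra automorphism $\varphi$ of $\Pi$ with $\eta(a)=\varphi(a)$. For a permutation $\rho$ of $P$, $\widehat\rho\left(\sum_{x\in P}a_xe_x\right)=\sum_{x\in P}a_xe_{\rho(x)}$. *)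

(* Defs.v *)
From HB Require Import structures.
From mathcomp Require Import all_boot all_algebra all_classical.

Set Implicit Arguments.
Unset Strict Implicit.
Unset Printing Implicit Defensive.

Import GRing.Theory.

Local Open Scope classical_set_scope.
Local Open Scope ring_scope.

Definition indecomposable (R : pzRingType) : Prop :=
  forall e : R, e * e = e -> e = 0 \/ e = 1.

(* The full product of copies of R indexed by P. The ring and module structures
   on functions are the pointwise ones; R^o makes R a module over itself.
   P may be empty, in which case this ring is zero: MathComp's algebra
   structures exclude the zero ring, so algebra automorphisms are spelled out
   below instead of being taken in {lrmorphism _ -> _}. *)
Notation full_product P R := (P -> R^o).

Section FullProduct.
Variables (R : comPzRingType) (P : Type).
Implicit Types (a : full_product P R) (phi eta : full_product P R -> full_product P R).

Definition basis_elt (x : P) : full_product P R :=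
  fun y => `[< y = x >]%:R.

Definition is_alg_aut phi : Prop :=
  [/\ linear phi, monoid_morphism phi & bijective phi].

Definition is_local_aut eta : Prop :=
  linear eta /\ forall a, exists2 phi, is_alg_aut phi & eta a = phi a.

(* The coefficient of e_y in the sum of the a_x e_(rho x) is a_x for the unique x
   with rho x = y. A permutation of the possibly infinite type P is a bijection
   packaged with its two-sided inverse. *)
Definition perm_hat (rho : {splitbij [set: P] >-> [set: P]}) a :
  full_product P R := fun y => a (rho^-1%FUN y).

Lemma perm_hatE (rho : {splitbij [set: P] >-> [set: P]}) a (x : P) :
  perm_hat rho a (rho x) = a x.
Proof. by rewrite /perm_hat funK// in_setT. Qed.

End FullProduct.

(* Main.v *)
(** An algebra automorphism permutes the primitive idempotents e_x, so it is
    precomposition with a bijection of P. A local automorphism eta therefore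
    permutes the e_x as well (surjectively, by the hypothesis on the image);
    after composing with a permutation we may assume that eta fixes every e_x,
    while each value of eta a is still a value of a. A map of this kind fixes the
    indicator function of every subset A. Finally, if s = (eta a)_x differs from
    a_x, let A be the set of coordinates where a takes the value s: the function
    a + 1_A omits the value s, but eta (a + 1_A) takes it at x. *)

Require Import Defs.
From mathcomp Require Import all_boot all_algebra all_classical.

Set Implicit Arguments.
Unset Strict Implicit.
Unset Printing Implicit Defensive.

Import GRing.Theory.

Local Open Scope classical_set_scope.
Local Open Scope card_scope.
Local Open Scope ring_scope.

Section FullProduct.
Variables (R : comPzRingType) (P : Type).
Implicit Types (x y : P) (a b : full_product P R) (phi eta : full_product P R -> full_product P R).

(** * Coordinate idempotents and algebra automorphisms *)

Lemma basis_elt_diag x : basis_elt R x x = 1 :> R.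
Proof. by rewrite /basis_elt asboolT. Qed.

Lemma basis_elt_off (x y : P) : y <> x -> basis_elt R x y = 0 :> R.
Proof. by move=> yx; rewrite /basis_elt asboolF. Qed.

Lemma mul_basis_elt a x : a * basis_elt R x = a x *: basis_elt R x.
Proof.
apply/funext => y; rewrite !fctE /GRing.scale /=.
have [->//|yx] := pselect (y = x).
by rewrite basis_elt_off // !mulr0.
Qed.

Lemma basis_elt_idem (x : P) : basis_elt R x * basis_elt R x = basis_elt R x.
Proof. by rewrite mul_basis_elt basis_elt_diag scale1r. Qed.

Lemma basis_elt_inj : (1 : R) != 0 -> injective (basis_elt R (P := P)).
Proof.
move=> R1 x y exy; have [//|xy] := pselect (x = y).
have := basis_elt_diag x; rewrite exy basis_elt_off // => /eqP.
by rewrite eq_sym (negPf R1).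
Qed.

Lemma basis_elt_neq0 (x : P) : (1 : R) != 0 -> basis_elt R x <> 0.
Proof.
move=> R1 /(congr1 (fun f => f x)); rewrite basis_elt_diag => /eqP.
by rewrite (negPf R1).
Qed.

Lemma idem_01 a x : indecomposable R -> a * a = a -> a x = 0 \/ a x = 1.
Proof. by move=> Ri aa; apply: Ri; have /(congr1 (fun f => f x)) := aa. Qed.

Lemma idem_neq0 a : indecomposable R -> a * a = a -> a <> 0 ->
  exists x, a x = 1.
Proof.
move=> Ri aa a0; apply: contrapT => /forallNP an1; apply: a0.
by apply/funext => x; have [//|/an1] := idem_01 x Ri aa.
Qed.

Lemma linear_zero phi : linear phi -> phi 0 = 0.
Proof.
move=> lphi; have := lphi 1 0 0.
by rewrite !scale1r addr0 => /esym/eqP; rewrite -subr_eq0 addrK => /eqP.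
Qed.

Lemma linear_add phi a b : linear phi -> phi (a + b) = phi a + phi b.
Proof. by move=> lphi; have := lphi 1 a b; rewrite !scale1r. Qed.

Lemma linear_scale phi (r : R) a : linear phi -> phi (r *: a) = r *: phi a.
Proof. by move=> lphi; have := lphi r a 0; rewrite (linear_zero lphi) !addr0. Qed.

Lemma linear_sub phi a b : linear phi -> phi (a - b) = phi a - phi b.
Proof. by move=> lphi; rewrite -scaleN1r addrC lphi scaleN1r addrC. Qed.

(** The preimage [b] of [e_y] is a nonzero idempotent, so [b x = 1] for some [x]. Then
    [b * e_x = e_x], which makes [phi e_x] a multiple of [e_y] by 0 or 1, and injectivity excludes
    0. *)
Lemma alg_aut_basis_elt phi (y : P) : indecomposable R -> (1 : R) != 0 ->
  is_alg_aut phi -> exists x, phi (basis_elt R x) = basis_elt R y.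
Proof.
move=> Ri R1 [lphi [_ mphi] [psi phiK psiK]].
have pinj := can_inj phiK.
pose b := psi (basis_elt R y).
have pb : phi b = basis_elt R y by exact: psiK.
have bb : b * b = b by apply: pinj; rewrite mphi pb basis_elt_idem.
have b0 : b <> 0.
  by move=> b0; apply: (@basis_elt_neq0 y R1); rewrite -pb b0 linear_zero.
have [x bx] := idem_neq0 Ri bb b0; exists x.
pose c := phi (basis_elt R x).
have cc : c * c = c by rewrite -mphi basis_elt_idem.
have cE : c = c y *: basis_elt R y.
  by rewrite -mul_basis_elt -pb -mphi mulrC mul_basis_elt bx scale1r.
have [cy|cy] := idem_01 y Ri cc; last by rewrite -/c cE cy scale1r.
exfalso; apply: (@basis_elt_neq0 x R1); apply: pinj.
by rewrite -/c cE cy scale0r linear_zero.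
Qed.

(** With [f y] chosen so that [phi] sends [e_(f y)] to [e_y], multiplying [phi a] by [e_y] reads off
    its coordinate at [y] as [a (f y)]. *)
Lemma alg_aut_comp phi : indecomposable R -> (1 : R) != 0 -> is_alg_aut phi ->
  exists2 f : P -> P, bijective f & forall a, phi a = a \o f.
Proof.
move=> Ri R1 pa.
have /choice[f fE] := fun y => alg_aut_basis_elt y Ri R1 pa.
have [lphi [_ mphi] [psi phiK _]] := pa.
have phiE a : phi a = a \o f.
  apply/funext => y.
  have : phi a * basis_elt R y = a (f y) *: basis_elt R y.
    by rewrite -fE -mphi mul_basis_elt linear_scale.
  rewrite mul_basis_elt => /(congr1 (fun g => g y)).
  by rewrite !fctE basis_elt_diag /GRing.scale /= !mulr1.
exists f; last exact: phiE.
rewrite -setTT_bijective; split; first by move=> ? _.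
  by move=> x y _ _ fxy; apply: (basis_elt_inj R1); rewrite -(fE x) -(fE y) fxy.
(* If [f] missed [x], then [phi e_x = e_x \o f] would vanish. *)
move=> x _; apply: contrapT => xf.
apply: (@basis_elt_neq0 x R1); apply: (can_inj phiK).
rewrite linear_zero // phiE; apply/funext => y /=.
by rewrite basis_elt_off // => fyx; apply: xf; exists y.
Qed.

(** * Local automorphisms and the coordinate idempotents *)

Section LocalAutomorphism.
Variable eta : full_product P R -> full_product P R.
Hypotheses (Ri : indecomposable R) (R1 : (1 : R) != 0).
Hypothesis eta_local : is_local_aut eta.

Lemma local_aut_comp a : exists2 f : P -> P, bijective f & eta a = a \o f.
Proof.
have [phi pa ->] := eta_local.2 a.
by have [f fb fE] := alg_aut_comp Ri R1 pa; exists f.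
Qed.

(** If [eta (a - b)] is zero, so is [a - b], being zero after precomposition with a bijection. *)
Lemma local_aut_inj : injective eta.
Proof.
move=> a b ab; apply/eqP; rewrite -subr_eq0; apply/eqP.
have [f [g _ gK] fE] := local_aut_comp (a - b).
apply/funext => x; rewrite -[x]gK -[LHS]/(((a - b) \o f) (g x)) -fE.
by rewrite linear_sub ?ab ?subrr //; exact: eta_local.1.
Qed.

Lemma local_aut_basis_elt x : exists y, eta (basis_elt R x) = basis_elt R y.
Proof.
have [f [g fK gK] ->] := local_aut_comp (basis_elt R x).
exists (g x); apply/funext => y; rewrite /basis_elt /=; congr (_%:R).
by congr (nat_of_bool _); apply/asbool_equiv_eq; split=> [<-|->].
Qed.

Lemma local_aut_basis_elt_preim a y :
  eta a = basis_elt R y -> exists x, a = basis_elt R x.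
Proof.
have [f [g fK gK] ->] := local_aut_comp a => aE.
exists (f y); apply/funext => x.
have -> : a x = (a \o f) (g x) by rewrite /= gK.
rewrite aE /basis_elt; congr (_%:R).
by congr (nat_of_bool _); apply/asbool_equiv_eq; split=> [<-|->].
Qed.

(** Injectivity of [f] comes from that of [eta]; surjectivity comes from the image hypothesis, since
    a preimage of [e_y] is itself some [e_x]. *)
Lemma local_aut_basis_perm : (forall x, range eta (basis_elt R x)) ->
  exists2 f : P -> P, bijective f &
    forall x, eta (basis_elt R x) = basis_elt R (f x).
Proof.
move=> im; have /choice[f fE] := local_aut_basis_elt.
exists f; last exact: fE.
rewrite -setTT_bijective; split; first by move=> ? _.
  move=> x y _ _ fxy; apply: (basis_elt_inj R1); apply: local_aut_inj.
  by rewrite !fE fxy.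
move=> y _; have [a _ ea] := im y.
have [x ax] := local_aut_basis_elt_preim ea; exists x => //.
by apply: (basis_elt_inj R1); rewrite -fE -ax.
Qed.

End LocalAutomorphism.

(** * Linear maps whose values are values of the argument *)

Definition indicator (A : set P) : full_product P R := fun y => `[< A y >]%:R.

Lemma indicatorT (A : set P) x : A x -> indicator A x = 1.
Proof. by move=> Ax; rewrite /indicator asboolT. Qed.

Lemma indicatorF (A : set P) x : ~ A x -> indicator A x = 0.
Proof. by move=> Ax; rewrite /indicator asboolF. Qed.

Lemma indicator_setC (A : set P) : indicator (~` A) = 1 - indicator A.
Proof.
apply/funext => x; rewrite !fctE.
have [Ax|nAx] := pselect (A x); last first.
  by rewrite indicatorT // indicatorF // subr0.
by rewrite indicatorF ?(indicatorT Ax) ?subrr //; exact.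
Qed.

Section ValuePreserving.
Variable eta : full_product P R -> full_product P R.
Hypothesis eta_linear : linear eta.
Hypothesis eta_val : forall a y, exists z, eta a y = a z.
Hypothesis eta_basis : forall x, eta (basis_elt R x) = basis_elt R x.
Variable t : R.
Hypotheses (R1 : (1 : R) != 0) (t0 : t != 0) (t1 : t + 1 != 0).

Lemma eta_one : eta 1 = 1.
Proof. by apply/funext => y; have [z ->] := eta_val 1 y. Qed.

(* If x is outside A, the values of [1_A + t e_x] are among 0, 1, t; its image
   would have the value [1 + t] at x. *)
Lemma eta_indicator_out (A : set P) x : ~ A x -> eta (indicator A) x = 0.
Proof.
move=> nAx; have [z1 e1] := eta_val (indicator A) x.
have [Az1|nAz1] := pselect (A z1); last by rewrite e1 indicatorF.
have [z] := eta_val (t *: basis_elt R x + indicator A) x.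
rewrite eta_linear eta_basis !fctE basis_elt_diag e1 indicatorT //.
rewrite /GRing.scale /= mulr1.
have [->|zx] := pselect (z = x).
  rewrite basis_elt_diag indicatorF // addr0 mulr1 => /eqP.
  by rewrite -subr_eq0 addrAC subrr add0r (negPf R1).
rewrite basis_elt_off // mulr0 add0r.
have [Az|nAz] := pselect (A z).
  by rewrite indicatorT // => /eqP; rewrite -subr_eq0 addrK (negPf t0).
by rewrite indicatorF // => /eqP; rewrite (negPf t1).
Qed.

(** On [A] itself, the vanishing result is applied to the complement, whose indicator is [1 - 1_A],
    and [eta 1 = 1]. *)
Lemma eta_indicator (A : set P) : eta (indicator A) = indicator A.
Proof.
apply/funext => x; have [Ax|nAx] := pselect (A x); last first.
  by rewrite eta_indicator_out // indicatorF.
have : eta (indicator (~` A)) x = 0 by apply: eta_indicator_out; exact.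
rewrite indicator_setC linear_sub // eta_one !fctE => /eqP.
by rewrite subr_eq0 => /eqP <-; rewrite indicatorT.
Qed.

Lemma value_preserving_id a : eta a = a.
Proof.
apply/funext => x; apply: contrapT => /eqP eax.
pose A := [set y | a y = eta a x].
have nAx : ~ A x by move=> Ax; rewrite -Ax eqxx in eax.
have [z] := eta_val (a + indicator A) x.
rewrite linear_add // eta_indicator !fctE (indicatorF nAx) addr0.
(* With [s = eta a x], the value of [a + 1_A] at [z] is [s + 1] on [A], and off [A] it is [a z],
   different from [s] by the choice of [A]. *)
have [Az|nAz] := pselect (A z).
  rewrite indicatorT // Az => /eqP.
  by rewrite -subr_eq0 opprD addrA subrr add0r oppr_eq0 (negPf R1).
by rewrite indicatorF // addr0 => /esym/nAz.
Qed.

End ValuePreserving.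

End FullProduct.

(** Otherwise every element is 0 or -1, so [R] is covered by the image of a two-element set. *)
Lemma exists_neq0_neqN1 (R : pzRingType) : `I_3 #<= [set: R] ->
  exists t : R, t != 0 /\ t + 1 != 0.
Proof.
move=> R3; apply: contrapT => /forallNP nt.
suff : `I_3 #<= `I_2 by rewrite card_le_II.
pose g (n : nat) : R := if n == 0%N then 0 else -1.
apply: (card_le_trans R3); apply: card_le_trans (card_image_le g _).
apply: subset_card_le => t _.
have [t0|t0] := eqVneq t 0; first by exists 0%N.
have [/eqP t1|t1] := eqVneq (t + 1) 0; last by case: (nt t).
by exists 1%N => //; move: t1; rewrite addr_eq0 => /eqP ->.
Qed.

Lemma neq0_oner_neq0 (R : pzRingType) (t : R) : t != 0 -> (1 : R) != 0.
Proof. by apply: contraNneq => e; rewrite -[t]mulr1 e mulr0. Qed.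

Lemma perm_hat_alg_aut (R : comPzRingType) (P : Type)
  (rho : {splitbij [set: P] >-> [set: P]}) : is_alg_aut (@perm_hat R P rho).
Proof.
split=> //; exists (fun a => a \o rho) => a; apply/funext => x.
  exact: perm_hatE.
by rewrite /perm_hat /= invK // in_setT.
Qed.

Theorem theorem3p6 (R : comPzRingType) (P : Type)
    (eta : full_product P R -> full_product P R)
    (R_indec : indecomposable R)
    (R_ge3 : `I_3 #<= [set: R])
    (eta_local : is_local_aut eta)
    (basis_in_image : forall x : P, range eta (basis_elt R x)) :
  is_alg_aut eta /\
  exists rho : {splitbij [set: P] >-> [set: P]}, eta = perm_hat rho.
Proof.
have [t [t0 t1]] := exists_neq0_neqN1 R_ge3.
have R1 := neq0_oner_neq0 t0.
have [f fbij fE] := local_aut_basis_perm R_indec R1 eta_local basis_in_image.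
have [rho frho] := PbijTT fbij; rewrite {}frho in fbij fE.
suff etaE : eta = perm_hat rho.
  by split; [rewrite etaE; exact: perm_hat_alg_aut | exists rho].
(* Precomposing with [rho] normalises [eta]: [e_(rho x) \o rho = e_x], so every basis element
   becomes fixed. *)
have id_comp a : eta a \o rho = a.
  apply: (value_preserving_id (eta := fun b => eta b \o rho) _ _ _ R1 t0 t1).
  - by move=> r b c; rewrite eta_local.1.
  (* The bijection [h] depends on [b], but one value at a time is enough here. *)
  - move=> b y; have [h _ ->] := local_aut_comp R_indec R1 eta_local b.
    by exists (h (rho y)).
  - move=> x; rewrite fE; apply/funext => y; rewrite /basis_elt /=.
    congr (nat_of_bool _)%:R; apply/asbool_equiv_eq; split=> [|->//].
    exact: bij_inj fbij _ _.
apply/funext => a; apply/funext => y.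
by rewrite /perm_hat -{2}(id_comp a) /= invK // in_setT.
Qed.
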